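(* Let $I$ be a nonempty finite set. For any linear order $i_1i_2\cdots i_n$ on $I$, $$\mathtt{D}_I\triangleright\mathtt{H}_{i_1i_2\cdots i_n}=[\dots[\mathtt{H}_{i_1},\mathtt{H}_{i_2}],\dots,\mathtt{H}_{i_n}].$$
   Context: Let $\Bbbk$ be the base field. For a finite set $I$, $\mathbf{L}[I]$ is the $\Bbbk$-vector space with basis $\mathtt{H}_\ell$ indexed by linear orders $\ell$ on $I$, written as lists. For $I=S\sqcup T$ (disjoint subsets with union $I$), $\mu_{S,T}(\mathtt{H}_{\ell_1}\otimes\mathtt{H}_{\ell_2})=\mathtt{H}_{\ell_1\cdot\ell_2}$ (concatenation) and $\Delta_{S,T}(\mathtt{H}_\ell)=\mathtt{H}_{\ell|_S}\otimes\mathtt{H}_{\ell|_T}$ (restriction). These make $\mathbf{L}$ a connected bimonoid in species. A composition $F=(I_1,\dots,I_k)\vDash I$ is a sequence of pairwise disjoint nonempty subsets with union $I$; $\ell(F)=k$, and $\omega(F)=I_k$. Let $\mu_F:\mathbf{L}[I_1]\otimes\cdots\otimes\mathbf{L}[I_k]\to\mathbf{L}[I]$ and $\Delta_F:\mathbf{L}[I]\to\mathbf{L}[I_1]\otimes\cdots\otimes\mathbf{L}[I_k]$ be the iterated product and coproduct (identities for $k=1$). $\mathbf{\Sigma}[I]$ is the vector space with basis $\mathtt{H}_F$, $F\vDash I$, and for $z=\sum_F a_F\mathtt{H}_F\in\mathbf{\Sigma}[I]$ and $h\in\mathbf{L}[I]$ one puts $z\triangleright h=\sum_F a_F\,\mu_F\Delta_F(h)$.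 The Dynkin quasi-idempotent is $\mathtt{D}_I=\sum_{F\vDash I}(-1)^{\ell(F)-1}|\omega(F)|\,\mathtt{H}_F\in\mathbf{\Sigma}[I]$. The commutator bracket of $x\in\mathbf{L}[S]$, $y\in\mathbf{L}[T]$ is $[x,y]=\mu_{S,T}(x\otimes y)-\mu_{T,S}(y\otimes x)$. $\mathtt{H}_i\in\mathbf{L}[\{i\}]$ is the basis element of the unique order on $\{i\}$. The right-hand side of the claim is the left-nested bracketing $[\dots[[\mathtt{H}_{i_1},\mathtt{H}_{i_2}],\mathtt{H}_{i_3}],\dots,\mathtt{H}_{i_n}]$ (equal to $\mathtt{H}_{i_1}$ if $n=1$). *)

(* Defs.v *)
From HB Require Import structures.
From mathcomp Require Import all_boot all_order all_algebra.

Set Implicit Arguments.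
Unset Strict Implicit.
Unset Printing Implicit Defensive.

Import GRing.Theory.
Local Open Scope ring_scope.

(* Finite sets are the sets I : {set T} over a finType T.                     *)

(* The vector space over k with basis indexed by B.                           *)
Notation freemod k B := {ffun B -> (k : fieldType)^o}.

Section Free.
Variable k : fieldType.

Definition basis (B : finType) (b : B) : freemod k B :=
  [ffun b' => (b' == b)%:R].

Definition linext (B C : finType) (f : B -> freemod k C) (x : freemod k B) :
  freemod k C := \sum_b x b *: f b.

(* The tensor product of the spaces with bases B and C is identified with the *)
(* space with basis B * C, basis (b, c) being basis b (x) basis c.            *)
Definition tens (B C : finType) (x : freemod k B) (y : freemod k C) :
  freemod k (B * C)%type := [ffun p => x p.1 * y p.2].

Definition tensmap (B C B' C' : finType) (f : freemod k B -> freemod k B')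
    (g : freemod k C -> freemod k C') :
    freemod k (B * C)%type -> freemod k (B' * C')%type :=
  linext (fun p => tens (f (basis p.1)) (g (basis p.2))).

End Free.

(* Linear orders on I, written as lists: the val of an element is the list.   *)
Definition linord (T : finType) (I : {set T}) : finType :=
  seq_sub (permutations (enum I)).

Notation Lsp k I := (freemod k (linord I)).

Section LinearOrders.
Variables (k : fieldType) (T : finType).
Implicit Types (A B I : {set T}) (F : seq {set T}) (s : seq T).

(* H_s in L[I]; it is 0 when s is not a linear order on I.  Thanks to this    *)
(* convention the maps below take the target set I as an argument; they are   *)
(* only meaningful, and only used, when I is the disjoint union of A and B.   *)
Definition Hlist I s : Lsp k I := [ffun l : linord I => (val l == s)%:R].

(* The identity of L[I] when A = I.                                           *)
Definition Lcast A I : Lsp k A -> Lsp k I :=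
  linext (fun l : linord A => Hlist I (val l)).

Definition mu A B I : freemod k (linord A * linord B)%type -> Lsp k I :=
  linext (fun p : linord A * linord B => Hlist I (val p.1 ++ val p.2)).

Definition delta A B I : Lsp k I -> freemod k (linord A * linord B)%type :=
  linext (fun l : linord I =>
    tens (Hlist A [seq i <- val l | i \in A])
         (Hlist B [seq i <- val l | i \in B])).

(* Basis of L[I_1] (x) ... (x) L[I_n], associated to the right; the empty     *)
(* tensor product is k.                                                       *)
Fixpoint linords F : finType :=
  match F with
  | [::] => unit
  | [:: A] => linord A
  | A :: F' => (linord A * linords F')%type
  end.

Fixpoint muF F I : freemod k (linords F) -> Lsp k I :=
  match F return freemod k (linords F) -> Lsp k I with
  | [::] => fun x => (x tt : k) *: Hlist I [::]
  | A :: F' =>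
    match F' return (freemod k (linords F') -> Lsp k (I :\: A)) ->
                    freemod k (linords (A :: F')) -> Lsp k I with
    | [::] => fun _ => @Lcast A I
    | _ :: _ => fun muF' x => mu I (tensmap id muF' x)
    end (@muF F' (I :\: A))
  end.

Fixpoint deltaF F I : Lsp k I -> freemod k (linords F) :=
  match F return Lsp k I -> freemod k (linords F) with
  | [::] => linext (fun l : linord I => (val l == [::])%:R *: basis k tt)
  | A :: F' =>
    match F' return (Lsp k (I :\: A) -> freemod k (linords F')) ->
                    Lsp k I -> freemod k (linords (A :: F')) with
    | [::] => fun _ => @Lcast I A
    | _ :: _ => fun deltaF' x => tensmap id deltaF' (delta A (I :\: A) x)
    end (@deltaF F' (I :\: A))
  end.

Definition bracket A B I (x : Lsp k A) (y : Lsp k B) : Lsp k I :=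
  mu I (tens x y) - mu I (tens y x).

(* [...[[x, H_(i_1)], H_(i_2)], ..., H_(i_n)] for s = i_1 ... i_n, as an      *)
(* element of L[I], where I is A together with the i_j.                       *)
Fixpoint nested_bracket I A (x : Lsp k A) s : Lsp k I :=
  if s is i :: s' then
    nested_bracket I
      (bracket (A :|: [set i]) x (Hlist [set i] [:: i])) s'
  else Lcast I x.

(* The left-nested bracketing of the H_i for i in s; s is meant to be         *)
(* nonempty.                                                                  *)
Definition left_bracketing I s : Lsp k I :=
  if s is i :: s' then nested_bracket I (Hlist [set i] [:: i]) s' else 0.

End LinearOrders.

Definition is_composition (T : finType) (I : {set T}) (F : seq {set T}) :=
  [&& set0 \notin F, pairwise (fun A B : {set T} => [disjoint A & B]) F
    & \bigcup_(A <- F) A == I].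

(* A composition of I has at most #|I| blocks, so bounding the length only    *)
(* serves to get a finType.                                                   *)
Definition composition (T : finType) (I : {set T}) : finType :=
  {F : #|I|.-bseq {set T} | is_composition I F}.

Definition blocks (T : finType) (I : {set T}) (F : composition I) :
  seq {set T} := val (val F).

Notation Sigma k I := (freemod k (composition I)).

Definition action (k : fieldType) (T : finType) (I : {set T})
    (z : Sigma k I) (h : Lsp k I) : Lsp k I :=
  \sum_(F : composition I) z F *: muF I (deltaF (blocks F) h).

Definition dynkin (k : fieldType) (T : finType) (I : {set T}) : Sigma k I :=
  \sum_(F : composition I)
    ((-1) ^+ (size (blocks F)).-1 * #|last set0 (blocks F)|%:R : k)
      *: basis k F.

(* Main.v *)
Require Import Defs.
From HB Require Import structures.
From mathcomp Require Import all_boot all_order all_algebra.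

Set Implicit Arguments.
Unset Strict Implicit.
Unset Printing Implicit Defensive.

Import GRing.Theory.
Local Open Scope ring_scope.

(* Summing over the last block first, D_I = \sum_(S u T = I) |T| a_S . H_T,
   where a_S = \sum_F (-1)^l(F) H_F acts on L[S] as the antipode
   H_w |-> (-1)^|S| H_(rev w).  Hence D_I sends H_w to
     \sum_(S u T = I) (-1)^|S| |T| H_(rev (w|S) w|T).
   The word rev (w|S) w|T does not change when the first letter i of w is
   moved between S and T, so that only \sum_S (-1)^|S| H_(rev (w|S) i w|T)
   remains, over the S not containing i; this is the expansion of the
   left-nested bracket.  The antipode and the weight |T| are treated
   together, by a recursion on the first block of a composition. *)

(** * Reindexing sums over subsets *)

Section Subsets.
Variables (T : finType) (V : zmodType).
Implicit Types (A J I : {set T}).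

(** Pairing [A] with [i |: A] is the form in which every toggling of a letter is carried out
    below. *)
Lemma sum_subset_setU1 i J (f : {set T} -> V) : i \notin J ->
  \sum_(A : {set T} | A \subset i |: J) f A =
  \sum_(A : {set T} | A \subset J) (f A + f (i |: A)).
Proof.
move=> iJ; rewrite (bigID (fun A : {set T} => i \in A)) /= addrC big_split /=.
congr (_ + _).
  apply: eq_bigl => A; apply/andP/idP => [[/subsetP sA iA]|sA].
    apply/subsetP=> x xA; move: (sA x xA); rewrite !inE => /orP[/eqP xi|//].
    by rewrite -xi xA in iA.
  split; first exact: subset_trans sA (subsetUr _ _).
  by apply: contra iJ => /(subsetP sA).
rewrite (reindex_onto (fun A => i |: A) (fun A => A :\ i)) /=; last first.
  by move=> A /andP[_ iA]; rewrite setD1K.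
apply: eq_bigl => A; rewrite setU11 andbT.
apply/andP/idP => [[sA /eqP eA]|sA].
  rewrite -eA; apply/subsetP=> x; rewrite !inE => /andP[/negbTE xi].
  rewrite xi /= => xA; move/subsetP: sA => /(_ x); rewrite !inE xi /=.
  exact.
split; first exact: setUS.
by rewrite setU1K //; apply: contra iJ => /(subsetP sA).
Qed.

(** Pairs of disjoint subsets [A], [S] of [I], with [A] nonempty, are regrouped by their union [J].
    In the recursion [A] is a first block and [S] a set of reversed letters. *)
Lemma sum_subset_setD I (f : {set T} -> {set T} -> V) :
  \sum_(A : {set T} | (A \subset I) && (A != set0))
     \sum_(S : {set T} | S \subset I :\: A) f A S =
  \sum_(J : {set T} | J \subset I)
     \sum_(A : {set T} | (A \subset J) && (A != set0)) f A (J :\: A).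
Proof.
rewrite [RHS](exchange_big_dep
  (fun A : {set T} => (A \subset I) && (A != set0))) /=;
  last by move=> J A sJ /andP[sA ->]; rewrite (subset_trans sA sJ).
apply: eq_bigr => A /andP[sAI A0].
rewrite (reindex_onto (fun J => J :\: A) (fun S => S :|: A)) /=; last first.
  move=> S; rewrite subsetD => /andP[_ /setDidPl dS].
  by rewrite setDUl setDv setU0.
apply: eq_bigl => J; rewrite A0 andbT.
apply/andP/andP => [[sJ /eqP eJ]|[sJ sA]].
  split; last by rewrite -eJ subsetUr.
  rewrite -eJ subUset sAI andbT; exact: subset_trans sJ (subsetDl _ _).
split; first exact: setSD.
by apply/eqP/setP=> x; rewrite !inE;
  case: (boolP (x \in A)) => [/(subsetP sA) ->|]; rewrite ?orbF ?andbT ?orbT.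
Qed.

End Subsets.

(** * Compositions by recursion on the first block *)

Section Compositions.
Variable T : finType.
Implicit Types (A B I : {set T}) (F : seq {set T}).

Lemma all_disjoint_bigcup A F :
  all (fun B => [disjoint A & B]) F = [disjoint A & \bigcup_(B <- F) B].
Proof.
elim: F => [|B F IHF] /=; first by rewrite big_nil -setI_eq0 setI0 eqxx.
by rewrite IHF big_cons -!setI_eq0 setIUr setU_eq0.
Qed.

Lemma is_composition_nil I : is_composition I [::] = (I == set0).
Proof. by rewrite /is_composition /= big_nil eq_sym. Qed.

(** For the union [U] of the later blocks, being disjoint from [A] and completing [A] to [I] amounts
    to [A \subset I] and [U = I :\: A]. *)
Lemma is_composition_cons I A F :
  is_composition I (A :: F) =
  [&& A != set0, A \subset I & is_composition (I :\: A) F].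
Proof.
rewrite /is_composition /= inE negb_or eq_sym all_disjoint_bigcup big_cons.
set U := \bigcup_(B <- F) B; rewrite -andbA; congr (_ && _).
have eU : ([disjoint A & U] && (A :|: U == I)) =
          ((A \subset I) && (U == I :\: A)).
  rewrite andbC.
  apply/andP/andP => [[/eqP <-]|[sA /eqP ->]].
    rewrite disjoint_sym => /setDidPl dU.
    by rewrite subsetUl setDUl setDv set0U dU.
  rewrite -setI_eq0 setIDA setIC -setIDA setDv setI0 eqxx; split=> //.
  by rewrite -{1}(setIidPr sA) setID.
move: eU; case: (_ \in F); case: (pairwise _ F);
  by rewrite ?andbT ?andbF //= => ->.
Qed.

(** Each block uses up at least one point, so the length bound built into [composition] excludes
    nothing. *)
Lemma size_composition I F : is_composition I F -> (size F <= #|I|)%N.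
Proof.
elim: F I => [|A F IHF] I //=; rewrite is_composition_cons.
case/and3P=> A0 sA /IHF; rewrite cardsD (setIidPr sA) => le_F.
apply: leq_ltn_trans le_F _; rewrite ltn_subrL card_gt0 A0 card_gt0.
by apply: contraNneq A0 => I0; rewrite -subset0 -I0.
Qed.

(** Plain sequences, free of the dependence of the type on [I]: compositions of different sets can
    be compared by [perm_eq] and sums over them reindexed. *)
Definition compositions I : seq (seq {set T}) :=
  [seq blocks F | F : composition I].

Lemma uniq_compositions I : uniq (compositions I).
Proof.
rewrite map_inj_uniq ?enum_uniq // => F F' eqF.
by do 2 apply: val_inj.
Qed.

Lemma mem_compositions I F : (F \in compositions I) = is_composition I F.
Proof.
apply/mapP/idP => [[F' _ ->]|cF]; first exact: (valP F').
have sF := size_composition cF.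
by exists (Sub (Bseq sF) cF : composition I); rewrite ?mem_enum.
Qed.

Lemma compositions0 : perm_eq (compositions set0) [:: [::]].
Proof.
apply: uniq_perm; rewrite ?uniq_compositions // => F.
rewrite mem_compositions inE; case: F => [|A F].
  by rewrite is_composition_nil eqxx.
rewrite is_composition_cons subset0; by case: eqP.
Qed.

Lemma compositionsE I : I != set0 ->
  perm_eq (compositions I)
    [seq A :: F | A <- enum [pred A : {set T} | (A \subset I) && (A != set0)],
                  F <- compositions (I :\: A)].
Proof.
move=> I0; apply: uniq_perm; first exact: uniq_compositions.
  apply: allpairs_uniq_dep => [|A _|]; rewrite ?enum_uniq ?uniq_compositions //.
  by move=> [A F] [A' F'] _ _ /= [-> ->].
move=> F; rewrite mem_compositions; apply/idP/allpairsPdep.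
  case: F => [|A F]; first by rewrite is_composition_nil (negbTE I0).
  rewrite is_composition_cons => /and3P[A0 sA cF]; exists A, F.
  by split; rewrite ?mem_enum ?inE ?sA ?mem_compositions.
case=> A [F' [+ + ->]]; rewrite mem_enum inE mem_compositions => /andP[sA A0].
by rewrite is_composition_cons sA A0.
Qed.

End Compositions.

(** * Linearity and values on basis vectors *)

Section FreeModules.
Variable k : fieldType.

Lemma linext_basis (B C : finType) (f : B -> freemod k C) b :
  linext f (basis k b) = f b.
Proof.
rewrite /linext (bigD1 b) //= ffunE eqxx scale1r big1 ?addr0 // => b' /negbTE.
by rewrite ffunE => ->; rewrite scale0r.
Qed.

Lemma linextD (B C : finType) (f : B -> freemod k C) x y :
  linext f (x + y) = linext f x + linext f y.
Proof.
by rewrite /linext -big_split; apply: eq_bigr => b _; rewrite ffunE scalerDl.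
Qed.

Lemma linextN (B C : finType) (f : B -> freemod k C) x :
  linext f (- x) = - linext f x.
Proof.
by rewrite /linext -sumrN; apply: eq_bigr => b _; rewrite ffunE scaleNr.
Qed.

Lemma tens_basis (B C : finType) (b : B) (c : C) :
  tens (basis k b) (basis k c) = basis k (b, c).
Proof.
apply/ffunP=> -[b' c']; rewrite !ffunE /= -natrM mulnb.
by rewrite xpair_eqE.
Qed.

Lemma tensmap_basis (B C B' C' : finType) (f : freemod k B -> freemod k B')
    (g : freemod k C -> freemod k C') b c :
  tensmap f g (basis k (b, c)) = tens (f (basis k b)) (g (basis k c)).
Proof. exact: linext_basis. Qed.

Lemma tensDl (B C : finType) (x y : freemod k B) (z : freemod k C) :
  tens (x + y) z = tens x z + tens y z.
Proof. by apply/ffunP=> p; rewrite !ffunE mulrDl. Qed.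

Lemma tensNl (B C : finType) (x : freemod k B) (z : freemod k C) :
  tens (- x) z = - tens x z.
Proof. by apply/ffunP=> p; rewrite !ffunE mulNr. Qed.

Lemma tensDr (B C : finType) (x : freemod k B) (y z : freemod k C) :
  tens x (y + z) = tens x y + tens x z.
Proof. by apply/ffunP=> p; rewrite !ffunE mulrDr. Qed.

Lemma tensNr (B C : finType) (x : freemod k B) (z : freemod k C) :
  tens x (- z) = - tens x z.
Proof. by apply/ffunP=> p; rewrite !ffunE mulrN. Qed.

End FreeModules.

(** * The operators [muF] and [deltaF] on words *)

Section Words.
Variables (k : fieldType) (T : finType).
Implicit Types (i : T) (A B I : {set T}) (s : seq T).

Definition is_linord I s := uniq s && [forall x, (x \in s) == (x \in I)].

Lemma is_linordP I s : reflect (uniq s /\ s =i I) (is_linord I s).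
Proof.
apply: (iffP andP) => -[us sI]; split=> //.
  by move=> x; apply/eqP/(forallP sI).
by apply/forallP=> x; rewrite sI.
Qed.

Lemma mem_linord I s : (s \in permutations (enum I)) = is_linord I s.
Proof.
rewrite mem_permutations; apply/idP/is_linordP => [p|[us sI]].
  rewrite (perm_uniq p) enum_uniq; split=> // x.
  by rewrite (perm_mem p) mem_enum.
by apply: uniq_perm; rewrite ?enum_uniq // => x; rewrite sI mem_enum.
Qed.

Lemma linord_val I (l : linord I) : is_linord I (val l).
Proof. by rewrite -mem_linord; apply: (valP l). Qed.

Lemma linord_ex I s : is_linord I s -> exists l : linord I, val l = s.
Proof. by rewrite -mem_linord => sI; exists (SeqSub sI). Qed.

Lemma Hlist_basis I (l : linord I) : Hlist k I (val l) = basis k l.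
Proof. by apply/ffunP=> l'; rewrite !ffunE. Qed.

Lemma is_linord_filter A I s : A \subset I -> is_linord I s ->
  is_linord A [seq x <- s | x \in A].
Proof.
move=> sA /is_linordP[us sI]; apply/is_linordP.
rewrite filter_uniq //; split=> //.
by move=> x; rewrite mem_filter sI; case: (boolP (x \in A)) => // /(subsetP sA).
Qed.

Lemma is_linord_cat A I s t : A \subset I ->
  is_linord A s -> is_linord (I :\: A) t -> is_linord I (s ++ t).
Proof.
move=> sA /is_linordP[us sE] /is_linordP[ut tE]; apply/is_linordP; split.
  rewrite cat_uniq us ut andbT; apply/hasPn=> x; rewrite tE sE inE.
  by case/andP.
move=> x; rewrite mem_cat sE tE !inE.
by case: (boolP (x \in A)) => // /(subsetP sA).
Qed.

Lemma Lcast_Hlist A I s : is_linord A s ->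
  Lcast I (Hlist k A s) = Hlist k I s.
Proof. by case/linord_ex=> l <-; rewrite Hlist_basis /Lcast linext_basis. Qed.

Lemma mu_Hlist A B I s t : is_linord A s -> is_linord B t ->
  mu I (tens (Hlist k A s) (Hlist k B t)) = Hlist k I (s ++ t).
Proof.
case/linord_ex=> a <- /linord_ex[b <-].
by rewrite !Hlist_basis tens_basis /mu linext_basis.
Qed.

Definition restrict_word (s : seq T) (F : seq {set T}) : seq T :=
  flatten [seq [seq x <- s | x \in A] | A : {set T} <- F].

(** The iterated coproduct restricts to [I :\: A] before restricting to the later blocks; the
    intermediate restriction leaves no trace. *)
Lemma restrict_word_filter B s F : all (fun A => A \subset B) F ->
  restrict_word [seq x <- s | x \in B] F = restrict_word s F.
Proof.
rewrite /restrict_word; elim: F => //= A F IHF /andP[sA /IHF ->].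
rewrite -filter_predI; congr (_ ++ _); apply: eq_filter => x /=.
by case: (boolP (x \in A)) => // /(subsetP sA).
Qed.

Lemma is_composition_sub I F :
  is_composition I F -> all (fun A => A \subset I) F.
Proof.
case/and3P=> _ _ /eqP <-; elim: F => //= A F IHF.
rewrite big_cons subsetUl /=; apply: sub_all IHF => B sB.
exact: subset_trans sB (subsetUr _ _).
Qed.

(** Coproducts send basis vectors to basis vectors, so a single index [p] describes the intermediate
    tensor. That the resulting word is a linear order is carried along because [mu_Hlist] requires
    it at the next block. *)
Lemma muF_deltaF_exists I F (l : linord I) : F != [::] -> is_composition I F ->
  [/\ is_linord I (restrict_word (val l) F) &
     exists2 p : linords F, deltaF F (basis k l) = basis k p
       & muF I (basis k p) = Hlist k I (restrict_word (val l) F)].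
Proof.
elim: F I l => [//|A [|A' F] IHF] I l _; rewrite is_composition_cons.
  (* [linords [:: A]] is [linord A] with no unit factor, so a single block is a base case of its
     own. *)
  case/and3P=> _ sAI; rewrite is_composition_nil setD_eq0 => sIA.
  have eA : A = I by apply/eqP; rewrite eqEsubset sAI.
  subst A; have -> : restrict_word (val l) [:: I] = val l.
    rewrite /restrict_word /= cats0; apply/all_filterP/allP=> x.
    by have /is_linordP[_ ->] := linord_val l.
  split; first exact: linord_val.
  exists l => /=; rewrite -Hlist_basis Lcast_Hlist //; exact: linord_val.
case/and3P=> _ sAI cF.
have lA := is_linord_filter sAI (linord_val l).
have lD := is_linord_filter (subsetDl I A) (linord_val l).
have [a ea] := linord_ex lA; have [b eb] := linord_ex lD.
have [lw [p ep mp]] := IHF _ b isT cF.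
have [c ec] := linord_ex lw.
have ew : restrict_word (val l) [:: A, A' & F] =
          val a ++ restrict_word (val b) (A' :: F).
  rewrite eb restrict_word_filter; last exact: is_composition_sub cF.
  by rewrite ea.
rewrite ew; split; first by apply: is_linord_cat lw; rewrite ?ea.
exists (a, p).
  rewrite [LHS]/=.
  rewrite [delta _ _ _]linext_basis -ea -eb !Hlist_basis tens_basis.
  by rewrite [LHS]tensmap_basis -[RHS]tens_basis; congr tens; apply: ep.
transitivity (mu I (tens (basis k a) (muF (I :\: A) (basis k p)))).
  by congr (mu I _); apply: tensmap_basis.
by rewrite mp -Hlist_basis mu_Hlist ?ea.
Qed.

Lemma muF_deltaF I F (l : linord I) : F != [::] -> is_composition I F ->
  muF I (deltaF F (basis k l)) = Hlist k I (restrict_word (val l) F).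
Proof. by move=> F0 cF; have [_ [p -> ->]] := muF_deltaF_exists l F0 cF. Qed.

End Words.

(** * Expansion of the nested bracket *)

Section NestedBracket.
Variables (k : fieldType) (T : finType).
Implicit Types (i : T) (A B I : {set T}) (s : seq T).

Lemma nested_bracketB I A (x y : Lsp k A) s :
  nested_bracket I (x - y) s = nested_bracket I x s - nested_bracket I y s.
Proof.
elim: s A x y => [|i s IHs] A x y /=; first by rewrite /Lcast linextD linextN.
rewrite -IHs; congr nested_bracket.
rewrite /bracket /mu tensDl tensNl tensDr tensNr !linextD !linextN.
by rewrite !opprD !opprK addrACA.
Qed.

Lemma is_linord1 i : is_linord [set i] [:: i].
Proof. by apply/is_linordP; split=> // x; rewrite !inE. Qed.

Lemma setU1_mem_seq i s : [set x in i :: s] = i |: [set x in s].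
Proof. by apply/setP=> x; rewrite !inE. Qed.

Lemma filter_notin1 i s : i \notin s ->
  forall A : {set T}, [seq x <- s | x \in i |: A] = [seq x <- s | x \in A].
Proof.
move=> is_ A; apply: eq_in_filter => x xs; rewrite !inE.
by case: eqP => // xi; rewrite -xi xs in is_.
Qed.

(** Bracketing with a letter appends it with sign [+] or prepends it with sign [-]. [S] collects the
    prepended letters, which end up in reverse order since later ones stand further left. *)
Lemma nested_bracket_Hlist I A w s : is_linord A w -> uniq s ->
  [disjoint A & s] -> A :|: [set x in s] = I ->
  nested_bracket I (Hlist k A w) s =
  \sum_(S : {set T} | S \subset [set x in s])
     (-1) ^+ #|S| *:
     Hlist k I (rev [seq x <- s | x \in S] ++ w ++ [seq x <- s | x \notin S]).
Proof.
elim: s A w => [|i s IHs] A w wA /=.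
  move=> _ _ <-; rewrite set_nil setU0 (big_pred1 set0) => [|S]; last first.
    by rewrite subset0.
  by rewrite cards0 expr0 scale1r /= cats0 Lcast_Hlist.
case/andP=> i_s us dis eI.
have iA : i \notin A.
  by apply/negP=> /(disjointFr dis); rewrite inE eqxx.
have disD : (A :|: [set i]) :\: A = [set i].
  by rewrite setDUl setDv set0U; apply/setDidPl; rewrite disjoints1.
have lwi : is_linord (A :|: [set i]) (w ++ [:: i]).
  by apply: (is_linord_cat (subsetUl _ _) wA); rewrite disD is_linord1.
have liw : is_linord (A :|: [set i]) (i :: w).
  apply: (@is_linord_cat _ [set i] _ [:: i]); rewrite ?subsetUr ?is_linord1 //.
  rewrite setDUl setDv setU0; have /setDidPl -> // : [disjoint A & [set i]].
  by rewrite disjoint_sym disjoints1.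
have disU : [disjoint A :|: [set i] & s].
  rewrite disjoint_subset.
  apply/subsetP=> x; rewrite !inE => /orP[xA|/eqP -> //].
  by have := disjointFr dis xA; rewrite inE => /norP[].
have eU : A :|: [set i] :|: [set x in s] = I by rewrite -setUA -setU1_mem_seq.
rewrite /bracket !mu_Hlist ?is_linord1 // nested_bracketB !IHs // setU1_mem_seq.
rewrite sum_subset_setU1 ?inE // -sumrB; apply: eq_bigr => S sS.
have iS : i \notin S by apply: contra i_s => /(subsetP sS); rewrite inE.
(* The subset [S] gives the words grown from [w ++ [:: i]], and [i |: S] those grown from
   [i :: w]. *)
rewrite (negbTE iS) /= setU11 /= -!catA cat1s; congr (_ + _).
rewrite cardsU1 iS exprS mulN1r scaleNr rev_cons filter_notin1 // cat_rcons.
congr (- (_ *: Hlist k I (_ ++ _ :: _ ++ _))).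
rewrite -[RHS](eq_in_filter (a1 := fun x => x \notin S)) // => x xs.
by rewrite !inE negb_or; case: eqP => // xi; rewrite -xi xs in i_s.
Qed.

End NestedBracket.

(** * Signed sums of words and the antipode *)

Section WordSums.
Variables (R : nzRingType) (T : finType) (V : lmodType R).
Implicit Types (A I J S C : {set T}) (W : seq T -> V) (l w s : seq T).

Lemma filter_set0 l : [seq x <- l | x \in set0] = [::].
Proof.
by rewrite (eq_filter (a2 := pred0)) ?filter_pred0 // => x; rewrite inE.
Qed.

(* The words for A and for A with the last letter of J toggled coincide. *)
Lemma antipode_cancel l J W : uniq l -> {subset J <= l} -> J != set0 ->
  \sum_(A : {set T} | A \subset J)
    (-1) ^+ #|J :\: A| *:
    W ([seq x <- l | x \in A] ++ rev [seq x <- l | x \in J :\: A]) = 0.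
Proof.
elim/last_ind: l J W => [|l i IHl] J W.
  by move=> _ sJ /set0Pn[x /sJ].
rewrite rcons_uniq => /andP[i_l ul] sJ J0.
have [iJ|iJ] := boolP (i \in J); last first.
  rewrite -[RHS](IHl J W ul _ J0) => [|x xJ]; last first.
    have := sJ x xJ; rewrite mem_rcons inE => /orP[/eqP xi|//].
    by rewrite -xi xJ in iJ.
  apply: eq_bigr => A sA; rewrite !filter_rcons !inE (negbTE iJ) andbF.
  by have /negbTE -> : i \notin A by apply: contra iJ => /(subsetP sA).
(* Whether [i] ends the word on [A] or begins the reversed word on its complement, it stands at
   their junction; only the sign changes. *)
rewrite -(setD1K iJ) sum_subset_setU1 ?setD11 // big1 // => A sA.
have iA : i \notin A by apply/negP=> /(subsetP sA); rewrite setD11.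
have eD1 : (i |: J :\ i) :\: A = i |: (J :\ i) :\: A.
  by apply/setP=> x; rewrite !inE; case: eqP => // ->; rewrite (negbTE iA).
have eD2 : (i |: J :\ i) :\: (i |: A) = (J :\ i) :\: A.
  by apply/setP=> x; rewrite !inE; case: eqP; rewrite ?andbF.
rewrite eD1 eD2 cardsU1 !filter_rcons !inE (negbTE iA) eqxx andbF /=.
rewrite !filter_notin1 // rev_rcons cat_rcons exprS mulN1r scaleNr.
by rewrite addNr.
Qed.

(** The sum of antipode terms weighted by the size of the last block, with a fixed prefix [w]. *)
Definition signed_sum l I w W : V :=
  \sum_(S : {set T} | S \subset I)
    ((-1) ^+ #|S| * #|I :\: S|%:R) *:
    W (w ++ rev [seq x <- l | x \in S] ++ [seq x <- l | x \in I :\: S]).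

(* C and w stand for the last block removed so far and for the word of the
   removed blocks, so that the recursion on the first block goes through. *)
Lemma sum_compositions l I C w W : uniq l -> {subset I <= l} ->
  \sum_(F : composition I)
    ((-1) ^+ size (blocks F) * #|last C (blocks F)|%:R) *:
    W (w ++ restrict_word l (blocks F)) =
  (if I == set0 then #|C|%:R *: W w else 0) - signed_sum l I w W.
Proof.
have [n le_n] := ubnP #|I|; elim: n => // n IHn in I C w le_n *.
move=> ul sI.
pose f F := ((-1) ^+ size F * #|last C F|%:R) *: W (w ++ restrict_word l F).
have sumE J (h : seq {set T} -> V) :
    \sum_(F : composition J) h (blocks F) = \sum_(F <- compositions J) h F.
  by rewrite big_image.
rewrite (sumE I f).
have [I0|I0] := eqVneq I set0.
  (* Only the empty composition remains and [last] returns its default [C]; all weights in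
     [signed_sum] are zero. *)
  subst I; rewrite (perm_big _ (compositions0 T)) big_seq1 /f /=.
  rewrite expr0 mul1r /restrict_word /= cats0 /signed_sum big1 ?subr0 // => S.
  by rewrite set0D cards0 mulr0 scale0r.
rewrite (perm_big _ (compositionsE I0)) big_allpairs_dep sub0r.
rewrite big_enum /=.
(* Removing the first block [A] costs one sign, extends the prefix, and makes [A] the new default
   for the last block. *)
transitivity (- \sum_(A : {set T} | (A \subset I) && (A != set0))
   ((if I :\: A == set0 then
       #|A|%:R *: W (w ++ [seq x <- l | x \in A]) else 0)
    - signed_sum l (I :\: A) (w ++ [seq x <- l | x \in A]) W)).
  rewrite -sumrN; apply: eq_bigr => A /andP[sA A0].
  rewrite -IHn //; first last.
  - by move=> x /setDP[/sI].
  - rewrite cardsD (setIidPr sA) -ltnS; apply: leq_trans le_n.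
    by rewrite ltnS ltn_subrL !card_gt0 A0.
  rewrite -sumE -sumrN; apply: eq_bigr => F _.
  by rewrite /f /= exprS !mulN1r !mulNr scaleNr catA.
rewrite sumrB opprB.
(* Only the one-block composition [A = I] contributes; its term is the one for [S = set0] in
   [signed_sum]. *)
have -> : \sum_(A : {set T} | (A \subset I) && (A != set0))
    (if I :\: A == set0 then #|A|%:R *: W (w ++ [seq x <- l | x \in A]) else 0)
  = #|I|%:R *: W (w ++ [seq x <- l | x \in I]).
  rewrite (bigD1 I) ?subxx //= setDv eqxx big1 ?addr0 // => A.
  rewrite setD_eq0 => /andP[/andP[sA _]]; rewrite eqEsubset sA /=.
  by move/negbTE=> ->.
rewrite /signed_sum [in RHS](bigD1 set0) ?sub0set //= cards0 setD0 expr0 mul1r.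
rewrite filter_set0.
rewrite opprD addrC; congr (_ + _).
pose g A S := ((-1) ^+ #|S| * #|I :\: (A :|: S)|%:R) *:
  W (w ++ [seq x <- l | x \in A] ++ rev [seq x <- l | x \in S] ++
     [seq x <- l | x \in I :\: (A :|: S)]).
transitivity (\sum_(A : {set T} | (A \subset I) && (A != set0))
   \sum_(S : {set T} | S \subset I :\: A) g A S).
  by apply: eq_bigr => A _; apply: eq_bigr => S _; rewrite /g -setDDl -!catA.
rewrite (sum_subset_setD _ g).
rewrite (bigD1 set0) ?sub0set //= big_pred0 ?add0r => [|A]; last first.
  by rewrite subset0 andbN.
(* For fixed [J] the weight [#|I :\: J|] is constant. The full sum over [A] vanishes by
   [antipode_cancel], so the nonempty [A] add up to minus the term for [A = set0], whose word is the
   reversed one on [J]. *)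
rewrite -sumrN; apply: eq_bigr => J /andP[sJ J0].
pose W' v := W (w ++ v ++ [seq x <- l | x \in I :\: J]).
have := @antipode_cancel l J W' ul (fun x xJ => sI x (subsetP sJ x xJ)) J0.
rewrite (bigD1 set0) ?sub0set //= setD0 filter_set0 /= => /eqP.
rewrite addrC addr_eq0 => /eqP/(congr1 (fun v => #|I :\: J|%:R *: v)).
rewrite scalerN scalerA /W' (commr_nat _ _) => <-.
rewrite scaler_sumr; apply: eq_bigr => A /andP[sA _].
have eJ : A :|: J :\: A = J by rewrite -{1}(setIidPr sA) setID.
by rewrite /g eJ scalerA (commr_nat _ _) -!catA.
Qed.
(* The words for S and for S with the first letter i toggled coincide, and
   their coefficients differ by a sign and by one unit of #|I :\: S|. *)
Lemma signed_sum_cons i s W : uniq (i :: s) ->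
  signed_sum (i :: s) [set x in i :: s] [::] W =
  \sum_(S : {set T} | S \subset [set x in s])
    (-1) ^+ #|S| *:
    W (rev [seq x <- s | x \in S] ++ [:: i] ++ [seq x <- s | x \notin S]).
Proof.
move=> /= /andP[i_s us]; rewrite /signed_sum setU1_mem_seq.
rewrite sum_subset_setU1 ?inE //; apply: eq_bigr => S sS.
have iS : i \notin S by apply: contra i_s => /(subsetP sS); rewrite inE.
have eD : (i |: [set x in s]) :\: S = i |: [set x in s] :\: S.
  by apply/setP=> x; rewrite !inE; case: eqP => // ->; rewrite (negbTE iS).
have eDU : (i |: [set x in s]) :\: (i |: S) = [set x in s] :\: S.
  apply/setP=> x; rewrite !inE; case: eqP => // ->.
  by rewrite (negbTE i_s) andbF.
have es : [seq x <- s | x \in [set x in s] :\: S] = [seq x <- s | x \notin S].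
  by apply: eq_in_filter => x xs; rewrite !inE xs andbT.
have iD : i \notin [set x in s] :\: S by rewrite !inE (negbTE i_s) andbF.
rewrite eD eDU !cardsU1 iS iD /= !setU11 (negbTE iS) (negbTE iD).
rewrite !filter_notin1 // es rev_cons cat_rcons exprS mulN1r mulNr scaleNr.
by rewrite natrD mulrDr scalerDl mulr1 addrK.
Qed.

End WordSums.

(** * The Dynkin quasi-idempotent on a linear order *)

Theorem theorem113 (k : fieldType) (T : finType) (I : {set T}) (l : linord I) :
  I != set0 ->
  action (dynkin k I) (basis k l) = left_bracketing k I (val l).
Proof.
move=> I0; have /is_linordP[ul lI] := linord_val l.
transitivity (signed_sum (val l) I [::] (Hlist k I)).
  have sI : {subset I <= val l} by move=> x; rewrite lI.
  (* [set0] is the default of [last] in [dynkin]. The sign exponent here is [size], against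
     [(size _).-1] in [dynkin], hence the global negation; the predecessor is a true one since the
     composition is nonempty. *)
  have := sum_compositions set0 [::] (Hlist k I) ul sI.
  rewrite (negbTE I0) sub0r => /(congr1 -%R); rewrite opprK => <-.
  rewrite -sumrN; apply: eq_bigr => F _.
  have F0 : blocks F != [::].
    by apply: contra I0 => /eqP F0; have := valP F; rewrite -/(blocks F) F0
      is_composition_nil.
  rewrite muF_deltaF //; last exact: (valP F).
  rewrite -scaleNr -mulNr; congr (_ *: _).
  rewrite /dynkin sum_ffunE (bigD1 F) //= big1 ?addr0 => [|G /negbTE GF].
    rewrite !ffunE eqxx [LHS]mulr1.
    by case: (blocks F) F0 => //= A G _; rewrite exprS mulN1r opprK.
  by rewrite !ffunE eq_sym GF scaler0.
have eI : I = [set x in val l] by apply/setP=> x; rewrite inE lI.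
case el: (val l) => [|i s].
  by rewrite eI el set_nil eqxx in I0.
rewrite el in ul eI.
have -> : signed_sum (i :: s) I [::] (Hlist k I) =
    signed_sum (i :: s) [set x in i :: s] [::] (Hlist k I) by rewrite -eI.
(* The nested bracket starts from the one-letter word [[:: i]] on [[set i]]. *)
rewrite signed_sum_cons //= nested_bracket_Hlist ?is_linord1 //.
- by case/andP: ul.
- case/andP: ul => i_s _; rewrite disjoint_subset.
  by apply/subsetP=> x /set1P ->.
- by rewrite eI setU1_mem_seq.
Qed.
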